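(* Let $\mathrm{VC}$ be the vertex-cover DP-core without size bound, and let $\tau$ be a $k$-instructive tree decomposition. Then $\mathrm{Inv}[\mathrm{VC},\mathcal{I}](G(\tau))$ is the binary encoding of the minimum size of a vertex cover in $G(\tau)$.
   Context: A graph is $G=(V,E,I)$ with $V,E$ finite subsets of $\mathbb{N}$, $I\subseteq E\times V$; a vertex cover is a set of vertices meeting every edge; $\simeq$ is isomorphism. Instructive tree decompositions: $\Sigma_k$ consists of $\mathrm{Leaf}$ (arity 0), $\mathrm{IntroVertex}_u$, $\mathrm{ForgetVertex}_u$, $\mathrm{IntroEdge}_{u,v}$ (arity 1), $\mathrm{Join}$ (arity 2), $u\ne v\in[k+1]$. $L_k$ (the $k$-instructive tree decompositions) is the set of terms accepted by the tree automaton with states all $B\subseteq[k+1]$ (all final), transitions $\mathrm{Leaf}\to\emptyset$; $\mathrm{IntroVertex}_u(B)\to B\cup\{u\}$ ($u\notin B$); $\mathrm{ForgetVertex}_u(B)\to B\setminus\{u\}$ ($u\in B$); $\mathrm{IntroEdge}_{u,v}(B)\to B$ ($u,v\in B$); $\mathrm{Join}(B,B)\to B$. Graph $G(\tau)$ with active labelled vertices: $\mathrm{Leaf}$: empty graph; $\mathrm{IntroVertex}_u$: add new vertex labelled $u$; $\mathrm{ForgetVertex}_u$: remove label $u$; $\mathrm{IntroEdge}_{u,v}$: add a new edge between the vertices labelled $u,v$; $\mathrm{Join}(\sigma_1,\sigma_2)$: glue disjoint copies of $G(\sigma_1),G(\sigma_2)$ identifying equally labelled active vertices. $\mathcal{I}=\{(\Sigma_k,L_k,G|_{L_k})\}_k$.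 For a DP-core with components $\hat a$, $\mathrm{Clean}_k$, $\mathrm{Inv}_k$: $\hat a(S_1,\dots,S_p)=\mathrm{Clean}_k(\bigcup_{w_i\in S_i}\hat a(w_1,\dots,w_p))$, $\mathrm{Dyn}_k(\mathrm{Leaf})=\widehat{\mathrm{Leaf}}$, $\mathrm{Dyn}_k(a(\tau_1,\dots))=\hat a(\mathrm{Dyn}_k(\tau_1),\dots)$. $\mathrm{Inv}[\mathrm{VC},\mathcal{I}](G)$ is $\mathrm{Inv}_{k'}(\mathrm{Dyn}_{k'}(\tau'))$ for any $\tau'\in L_{k'}$ with $G(\tau')\simeq G$, $k'$ minimal with $\tau'\in L_{k'}$. $\mathrm{VC}[k]$: witnesses $(R,s)$ with $R\subseteq[k+1]$, $s\in\mathbb{N}$, all final; $\mathrm{Clean}(S)$ keeps $(R,s)\in S$ iff no $(R,s')\in S$ with $s'<s$; $\mathrm{Inv}(S)=\min\{s:(R,s)\in S\}$ (in binary); $\widehat{\mathrm{Leaf}}=\{(\emptyset,0)\}$; $\widehat{\mathrm{IntroVertex}_u}(w)=\{w\}$; $\widehat{\mathrm{ForgetVertex}_u}(R,s)=\{(R\setminus\{u\},s)\}$; $\widehat{\mathrm{IntroEdge}_{u,v}}(R,s)=\{(R,s)\}$ if $u\in R$ or $v\in R$, else $\{(R\cup\{u\},s+1),(R\cup\{v\},s+1)\}$; $\widehat{\mathrm{Join}}((R,s),(R',s'))=\{(R\cup R',s+s'-|R\cap R'|)\}$. *)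

(* Defs.v *)
From Corelib Require Import BinNums.
From mathcomp Require Import all_boot.
From mathcomp Require Import finmap.

Set Implicit Arguments.
Unset Strict Implicit.
Unset Printing Implicit Defensive.

Local Open Scope fmap_scope.
Local Open Scope fset_scope.
Local Open Scope nat_scope.

(* Edges are objects of their own, so parallel edges are allowed. *)
Record graph := Graph {
  vertices : {fset nat};
  edges : {fset nat};
  incidence : {fset nat * nat};
  incidence_sub : incidence `<=` edges `*` vertices }.

Definition graph_iso (G H : graph) : Prop :=
  exists (f : vertices G -> vertices H) (g : edges G -> edges H),
    [/\ bijective f, bijective g &
      forall (e : edges G) (v : vertices G),
        ((val e, val v) \in incidence G)
        = ((val (g e), val (f v)) \in incidence H)].

Definition vertex_cover (G : graph) (X : {fset nat}) : Prop :=
  X `<=` vertices G /\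
  forall e, e \in edges G -> exists2 v, v \in X & (e, v) \in incidence G.

Definition min_vertex_cover_size (G : graph) (n : nat) : Prop :=
  (exists2 X, vertex_cover G X & #|` X| = n) /\
  (forall X, vertex_cover G X -> n <= #|` X|).

Inductive op1 :=
| IntroVertex (u : nat)
| ForgetVertex (u : nat)
| IntroEdge (u v : nat).

(* Labels are natural numbers, so that one and the same term can belong to
   the languages L k for several k. *)
Inductive term :=
| Leaf
| Op (a : op1) (t : term)
| Join (t1 t2 : term).

(* The label set [k+1] = {1, ..., k+1}. *)
Definition label (k : nat) : {fset nat} := [fset u | u in iota 1 k.+1].

Definition in_sigma (k : nat) (a : op1) : bool :=
  match a with
  | IntroVertex u | ForgetVertex u => u \in label k
  | IntroEdge u v => [&& u \in label k, v \in label k & u != v]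
  end.

(* [step a B B'] is the transition a(B) -> B'. *)
Inductive step : op1 -> {fset nat} -> {fset nat} -> Prop :=
| step_introV u B : u \notin B -> step (IntroVertex u) B (u |` B)
| step_forgetV u B : u \in B -> step (ForgetVertex u) B (B `\ u)
| step_introE u v B : u \in B -> v \in B -> step (IntroEdge u v) B B.

(* [reaches k t B]: some run of the automaton on t ends in the state B. *)
Inductive reaches (k : nat) : term -> {fset nat} -> Prop :=
| reaches_leaf : reaches k Leaf fset0
| reaches_op a t B B' :
    in_sigma k a -> reaches k t B -> step a B B' -> reaches k (Op a t) B'
| reaches_join t1 t2 B :
    reaches k t1 B -> reaches k t2 B -> reaches k (Join t1 t2) B.

(* All states B are final. *)
Definition L (k : nat) (t : term) : Prop := exists B, reaches k t B.

Record lgraph := LGraph {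
  lgraph_graph :> graph;
  active : {fmap nat -> nat};
  active_vertex :
    forall u v, active.[? u] = Some v -> v \in vertices lgraph_graph }.

Definition fresh (A : {fset nat}) : nat := (\max_(i <- A) i).+1.

Lemma graph0_sub : (fset0 : {fset nat * nat}) `<=` fset0 `*` fset0.
Proof. exact: fsub0set. Qed.

Definition graph0 : graph := Graph graph0_sub.

Lemma lgraph0_active (u v : nat) :
  ([fmap] : {fmap nat -> nat}).[? u] = Some v -> v \in vertices graph0.
Proof. by rewrite fnd_fmap0. Qed.

Definition lgraph0 : lgraph := LGraph lgraph0_active.

Section AddVertex.
Variables (u : nat) (G : lgraph).

Let x := fresh (vertices G).

Lemma add_vertex_sub : incidence G `<=` edges G `*` (x |` vertices G).
Proof.
apply/fsubsetP=> -[e v] /(fsubsetP (incidence_sub G)).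
by rewrite !in_fsetM /= in_fset1U => /andP[-> ->]; rewrite orbT.
Qed.

Lemma add_vertex_active w v :
  (active G).[u <- x].[? w] = Some v -> v \in x |` vertices G.
Proof.
rewrite fnd_set in_fset1U; case: eqP => [_ [->]|_ /active_vertex ->].
  by rewrite eqxx.
exact: orbT.
Qed.

Definition add_vertex : lgraph :=
  @LGraph (Graph add_vertex_sub) (active G).[u <- x] add_vertex_active.

End AddVertex.

Section ForgetLabel.
Variables (u : nat) (G : lgraph).

Lemma forget_label_active w v :
  (active G).[~ u].[? w] = Some v -> v \in vertices G.
Proof. by rewrite fnd_rem1; case: ifP => // _ /active_vertex. Qed.

Definition forget_label : lgraph := LGraph forget_label_active.

End ForgetLabel.

Section AddEdge.
Variables (u v : nat) (G : lgraph).

Let e0 := fresh (edges G).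

(* The vertices carrying label u or label v. *)
Definition edge_ends : {fset nat} :=
  [fset x in vertices G |
    ((active G).[? u] == Some x) || ((active G).[? v] == Some x)].

Lemma add_edge_sub :
  incidence G `|` [fset e0] `*` edge_ends
    `<=` (e0 |` edges G) `*` vertices G.
Proof.
apply/fsubsetP=> -[e x]; rewrite in_fsetU => /orP[|].
  move=> /(fsubsetP (incidence_sub G)).
  by rewrite !in_fsetM /= in_fset1U => /andP[-> ->]; rewrite orbT.
by rewrite !in_fsetM /= !inE => /andP[-> /andP[-> _]].
Qed.

Definition add_edge : lgraph :=
  @LGraph (Graph add_edge_sub) (active G) (@active_vertex G).

End AddEdge.

Section Glue.
Variables G1 G2 : lgraph.

(* The image of a vertex of G2 in the glued graph: the vertex of G1 carrying
   the same label, if there is one; otherwise a shifted copy, disjoint from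
   the vertices of G1. *)
Definition glue_vertex (y : nat) : nat :=
  if [pick x : vertices G1 |
        has (fun u => ((active G1).[? u] == Some (val x))
                      && ((active G2).[? u] == Some y)) (domf (active G1))]
    is Some x then val x else fresh (vertices G1) + y.

Definition glue_edge (e : nat) : nat := fresh (edges G1) + e.

Definition glue_vertices : {fset nat} :=
  vertices G1 `|` [fset glue_vertex y | y in vertices G2].

Definition glue_edges : {fset nat} :=
  edges G1 `|` [fset glue_edge e | e in edges G2].

Definition glue_incidence : {fset nat * nat} :=
  incidence G1
    `|` [fset (glue_edge ev.1, glue_vertex ev.2) | ev in incidence G2].

(* On labels active in both graphs the two components agree. *)
Definition glue_active : {fmap nat -> nat} :=
  catf [fmap u : domf (active G2) => glue_vertex (active G2 u)] (active G1).

Lemma glue_sub : glue_incidence `<=` glue_edges `*` glue_vertices.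
Proof.
apply/fsubsetP=> -[e x]; rewrite in_fsetU in_fsetM /= !in_fsetU.
case/orP=> [/(fsubsetP (incidence_sub G1))|].
  by rewrite in_fsetM /= => /andP[-> ->].
case/imfsetP=> -[e' x'] /= /(fsubsetP (incidence_sub G2)).
rewrite in_fsetM /= => /andP[He Hx] [-> ->].
by rewrite !in_imfset ?orbT.
Qed.

Lemma glue_active_vertex u v :
  glue_active.[? u] = Some v -> v \in glue_vertices.
Proof.
rewrite fnd_cat in_fsetU; case: ifP => [_ /active_vertex ->//|_].
case: fndP => // u_in [<-]; rewrite ffunE in_imfset ?orbT //=.
by apply: (@active_vertex G2 u); rewrite in_fnd.
Qed.

Definition glue : lgraph := @LGraph (Graph glue_sub) glue_active glue_active_vertex.

End Glue.

Definition apply_op (a : op1) (G : lgraph) : lgraph :=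
  match a with
  | IntroVertex u => add_vertex u G
  | ForgetVertex u => forget_label u G
  | IntroEdge u v => add_edge u v G
  end.

(* Total on terms; only its values on terms of some L k are meaningful. *)
Fixpoint lgraph_of (t : term) : lgraph :=
  match t with
  | Leaf => lgraph0
  | Op a t => apply_op a (lgraph_of t)
  | Join t1 t2 => glue (lgraph_of t1) (lgraph_of t2)
  end.

Definition graph_of (t : term) : graph := lgraph_of t.

(* The component of a DP-core at a fixed k. Acceptance (is_final) plays no role
   in the invariant of a graph. *)
Record dp_component := DPComponent {
  witness : choiceType;
  is_witness : pred witness;
  is_final : pred witness;
  leaf_hat : {fset witness};
  op_hat : op1 -> witness -> {fset witness};
  join_hat : witness -> witness -> {fset witness};
  clean : {fset witness} -> {fset witness};
  inv : {fset witness} -> bitseq }.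

Definition dp_core := nat -> dp_component.

Definition op_lift (D : dp_component) (a : op1) (S : {fset witness D}) :
    {fset witness D} :=
  clean (\bigcup_(w <- S) op_hat a w).

Definition join_lift (D : dp_component) (S1 S2 : {fset witness D}) :
    {fset witness D} :=
  clean (\bigcup_(w1 <- S1) \bigcup_(w2 <- S2) join_hat w1 w2).

Fixpoint Dyn (D : dp_component) (t : term) : {fset witness D} :=
  match t with
  | Leaf => leaf_hat D
  | Op a t => op_lift a (Dyn D t)
  | Join t1 t2 => join_lift (Dyn D t1) (Dyn D t2)
  end.

(* t is a decomposition of G, and k is the least index with t in L k. *)
Definition decomposes (G : graph) (k : nat) (t : term) : Prop :=
  [/\ L k t, forall j, L j t -> k <= j & graph_iso (graph_of t) G].

(* [core_inv D G s]: the invariant of the graph G computed by D is well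
   defined (some decomposition of G exists, and the outcome does not depend
   on which one is used) and equal to s. *)
Definition core_inv (D : dp_core) (G : graph) (s : bitseq) : Prop :=
  (exists k t, decomposes G k t) /\
  (forall k t, decomposes G k t -> inv (Dyn (D k) t) = s).

Fixpoint positive_bits (p : positive) : bitseq :=
  match p with
  | xH => [:: true]
  | xO q => rcons (positive_bits q) false
  | xI q => rcons (positive_bits q) true
  end.

(* Most significant bit first, no leading zero; 0 is encoded as "0". *)
Definition binary (n : nat) : bitseq :=
  match bin_of_nat n with
  | N0 => [:: false]
  | Npos p => positive_bits p
  end.

Definition vc_witness : choiceType := ({fset nat} * nat)%type.

Definition vc_op_hat (a : op1) (w : vc_witness) : {fset vc_witness} :=
  match a with
  | IntroVertex _ => [fset w]
  | ForgetVertex u => [fset (w.1 `\ u, w.2)]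
  | IntroEdge u v =>
      if (u \in w.1) || (v \in w.1) then [fset w]
      else [fset (u |` w.1, w.2.+1); (v |` w.1, w.2.+1)]
  end.

Definition vc_join_hat (w w' : vc_witness) : {fset vc_witness} :=
  [fset (w.1 `|` w'.1, w.2 + w'.2 - #|` w.1 `&` w'.1|)].

Definition vc_clean (S : {fset vc_witness}) : {fset vc_witness} :=
  [fset w in S | ~~ has (fun w' => (w'.1 == w.1) && (w'.2 < w.2)) S].

(* For nonempty S this is the minimum of the second components: the default
   of the iterated minimum is their maximum. *)
Definition vc_min (S : {fset vc_witness}) : nat :=
  \big[minn/ \max_(w <- S) w.2]_(w <- S) w.2.

Definition VC : dp_core := fun k =>
  {| witness := vc_witness;
     is_witness := fun w => w.1 `<=` label k;
     is_final := xpredT;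
     leaf_hat := [fset (fset0, 0)];
     op_hat := vc_op_hat;
     join_hat := vc_join_hat;
     clean := vc_clean;
     inv := fun S => binary (vc_min S) |}.

(* Main.v *)
(* A witness (R, s) of the dynamic program at t stands for a vertex cover of
   G(t) of size s meeting the labelled vertices exactly in R. Every computed
   witness comes from such a cover, but not every cover has its own witness,
   since vertices are selected only when an edge requires it. Instead, a cover X
   with set of labels T is dominated by some witness (R, s) with R contained in
   T and s + |T \ R| <= |X|. *)
Require Import Defs.
From mathcomp Require Import all_boot.
From mathcomp Require Import finmap zify.
From Stdlib Require Import Classical.

Set Implicit Arguments.
Unset Strict Implicit.
Unset Printing Implicit Defensive.

Local Open Scope fmap_scope.
Local Open Scope fset_scope.
Local Open Scope nat_scope.

(** * Fresh numbers and incidences *)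

(** The shift by [y] is the form needed for gluing, which moves edges and unshared vertices of the
    second graph past the first. *)
Lemma fresh_addn_notin (A : {fset nat}) y : fresh A + y \notin A.
Proof.
apply/negP => yA.
have le : fresh A + y <= \max_(i <- A) i.
  exact: (@leq_bigmax_seq _ (enum_fset A) xpredT id).
by move: le; rewrite /fresh; lia.
Qed.

Lemma fresh_notin (A : {fset nat}) : fresh A \notin A.
Proof. by rewrite -[fresh A]addn0 fresh_addn_notin. Qed.

Lemma incidence_edge (G : graph) e v : (e, v) \in incidence G -> e \in edges G.
Proof. by move=> /(fsubsetP (incidence_sub G)); rewrite in_fsetM => /andP[]. Qed.

Lemma incidence_vertex (G : graph) e v :
  (e, v) \in incidence G -> v \in vertices G.
Proof. by move=> /(fsubsetP (incidence_sub G)); rewrite in_fsetM => /andP[]. Qed.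

(** * Labels met by a cover, and the invariant *)

Definition trace (G : lgraph) (X : {fset nat}) : {fset nat} :=
  [fset u in domf (active G) |
    if (active G).[? u] is Some x then x \in X else false].

Lemma traceP (G : lgraph) (X : {fset nat}) u :
  reflect (exists2 x, (active G).[? u] = Some x & x \in X) (u \in trace G X).
Proof.
rewrite !inE /=; case: fndP => [uG|uG] /=.
- by apply: (iffP idP) => [xX|[x [<-]] //]; exists (active G).[uG].
- by constructor=> -[].
Qed.

(** [B] will be the automaton state. Injectivity of the labelling lets labels be counted in place of
    vertices. *)
Definition labelled_by (B : {fset nat}) (G : lgraph) : Prop :=
  (forall u, (u \in B) = isSome (active G).[? u]) /\
  (forall u w x, (active G).[? u] = Some x -> (active G).[? w] = Some x -> u = w).

Lemma labelled_active (B : {fset nat}) (G : lgraph) u :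
  labelled_by B G -> u \in B -> exists x, (active G).[? u] = Some x.
Proof. by case=> -> _; case: fnd => // x _; exists x. Qed.

Lemma leq_card_trace (B X : {fset nat}) (G : lgraph) :
  labelled_by B G -> #|` trace G X| <= #|` X|.
Proof.
case=> _ inj; pose h u := odflt 0 (active G).[? u].
have <- : #|` [fset h u | u in trace G X]| = #|` trace G X|.
  rewrite [LHS]card_in_imfset // => u w /traceP[x ux _] /traceP[y wy _].
  by rewrite /h ux wy /= => xy; rewrite -xy in wy; exact: inj ux wy.
apply/fsubset_leq_card/fsubsetP=> x /imfsetP[u /= /traceP[y uy yX] ->].
by rewrite /h uy.
Qed.

(* Completeness with the weaker bound [w.2 <= #|` X|] would not pass through
   joins: the traces of the two partial covers overlap more than the sets
   selected by their witnesses. *)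
Definition represents (G : lgraph) (S : {fset vc_witness}) : Prop :=
  [/\ exists w, w \in S,
      forall w, w \in S ->
        exists2 X, vertex_cover G X & #|` X| = w.2 /\ trace G X = w.1 &
      forall X, vertex_cover G X ->
        exists2 w, w \in S &
          w.1 `<=` trace G X /\ w.2 + #|` trace G X `\` w.1| <= #|` X|].

(** * Cleaning *)

Lemma vc_clean_sub S : vc_clean S `<=` S.
Proof. by apply/fsubsetP => w; rewrite !inE => /andP[]. Qed.

(** Passing to a strictly cheaper witness with the same label set must stop, as costs are natural
    numbers. *)
Lemma vc_clean_dominates S (w : vc_witness) :
  w \in S -> exists2 w', w' \in vc_clean S & w'.1 = w.1 /\ w'.2 <= w.2.
Proof.
have [n] := ubnP w.2; elim: n w => // n IHn w /ltnSE wn wS.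
have [/hasP[w' w'S /andP[/eqP w'1 w'2]]|no] :=
  boolP (has (fun w' : vc_witness => (w'.1 == w.1) && (w'.2 < w.2)) S).
- have [|w'' w''S [e le]] := IHn w' _ w'S; first exact: leq_trans w'2 wn.
  by exists w''; rewrite // e w'1; split=> //; apply: leq_trans le (ltnW w'2).
- by exists w; rewrite // !inE /= wS.
Qed.

Lemma represents_clean G S : represents G S -> represents G (vc_clean S).
Proof.
case=> -[w0 w0S] sound compl; split.
- by have [w wS _] := vc_clean_dominates w0S; exists w.
- by move=> w /(fsubsetP (vc_clean_sub S)) /sound.
- move=> X /compl[w /vc_clean_dominates[w' w'S [e le]] [sub le2]].
  by exists w'; rewrite // e; split=> //; apply: leq_trans le2; rewrite leq_add2r.
Qed.

(** * The empty graph *)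

Lemma represents_leaf : represents lgraph0 [fset (fset0, 0) : vc_witness].
Proof.
have tr0 X : trace lgraph0 X = fset0.
  by apply/fsetP=> u; rewrite inE; apply/traceP=> -[x]; rewrite fnd_fmap0.
split.
- by exists (fset0, 0); rewrite inE.
- move=> w; rewrite inE => /eqP ->; exists fset0; last by rewrite cardfs0 tr0.
  by split; [exact: fsub0set | move=> e; rewrite inE].
- move=> X _; exists (fset0, 0); first by rewrite inE.
  by rewrite tr0 fsub0set fsetD0 cardfs0.
Qed.

(** * Introducing a vertex *)

Lemma labelled_introV B u G :
  labelled_by B G -> u \notin B -> labelled_by (u |` B) (add_vertex u G).
Proof.
case=> domB inj uB; split=> [w|w1 w2 x]; rewrite !fnd_set.
  by rewrite in_fset1U domB; case: eqP.
have fr w : (active G).[? w] <> Some (fresh (vertices G)).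
  by move/active_vertex; apply/negP/fresh_notin.
case: eqP => [->|_]; case: eqP => [->|_] //; last exact: inj.
- by move=> [<-] /fr.
- by move=> + [xE]; rewrite -xE => /fr.
Qed.

(** The new vertex is isolated, so covers of [G] remain covers with the same trace. Conversely, when
    a cover contains it, dropping it lowers |X| by one and |T \ R| by at most one. *)
Lemma represents_introV B u G S :
  labelled_by B G -> u \notin B -> represents G S ->
  represents (add_vertex u G) (\bigcup_(w <- S) vc_op_hat (IntroVertex u) w).
Proof.
move=> labB uB [[w0 w0S] sound compl]; set x := fresh (vertices G).
have xG : x \notin vertices G by apply: fresh_notin.
have inS w : w \in S -> w \in \bigcup_(w <- S) vc_op_hat (IntroVertex u) w.
  by move=> wS; apply/bigfcupP; exists w; rewrite ?wS ?inE.
have anone : (active G).[? u] = None.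
  by case: labB uB => -> _; case: fnd.
have xA w y : (active G).[? w] = Some y -> y != x.
  by move/active_vertex => yG; apply: contraNneq xG => <-.
split; first by exists w0; apply: inS.
- move=> w /bigfcupP[w1 /andP[w1S _]]; rewrite inE => /eqP ->.
  have [X [XG cov] [cX tX]] := sound _ w1S; exists X.
    split=> //; apply/fsubsetP=> v /(fsubsetP XG) vG.
    by rewrite in_fset1U vG orbT.
  split=> //; rewrite -tX; apply/fsetP=> w'; apply/traceP/traceP => -[y].
    rewrite fnd_set; case: eqP => [_ [<-] /(fsubsetP XG)|_ wy yX]; last by exists y.
    by rewrite (negPf xG).
  move=> wy yX; exists y => //; rewrite fnd_set; case: eqP => // wu.
  by rewrite wu anone in wy.
- move=> X [XG cov].
  have [|w wS [sub le]] := compl (X `\ x).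
    split=> [|e eG].
      apply/fsubsetP=> v /fsetD1P[vx /(fsubsetP XG)].
      by rewrite in_fset1U (negPf vx).
    have [v vX ev] := cov e eG; exists v => //; rewrite in_fsetD1 vX andbT.
    apply: contraNneq xG => <-; exact: (@incidence_vertex G e).
  exists w; first exact: inS.
  (* The label [u] was inactive in [G], so it enters the trace exactly when the new vertex lies in
     [X]. *)
  have tE : trace (add_vertex u G) X =
      (if x \in X then [fset u] else fset0) `|` trace G (X `\ x).
    apply/fsetP=> w'; rewrite in_fsetU.
    have -> : (w' \in if x \in X then [fset u] else fset0) = (w' == u) && (x \in X).
      by case: ifP; rewrite !inE ?andbT ?andbF.
    apply/traceP/idP => [[y]|].
      rewrite fnd_set; case: eqP => [-> [<-] -> //|_ wy yX].
      by apply/orP; right; apply/traceP; exists y; rewrite // in_fsetD1 yX (xA _ _ wy).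
    case/orP=> [/andP[/eqP -> xX]|/traceP[y wy /fsetD1P[_ yX]]].
      by exists x; rewrite // fnd_set eqxx.
    exists y => //; rewrite fnd_set; case: eqP => // wu.
    by rewrite wu anone in wy.
  split; first by rewrite tE; apply: fsubset_trans sub (fsubsetUr _ _).
  rewrite tE fsetDUl (cardfsD1 x X).
  have le1 : #|` (if x \in X then [fset u] else fset0) `\` w.1| <= (x \in X).
    apply: leq_trans (fsubset_leq_card (fsubsetDl _ _)) _.
    by case: (x \in X); rewrite ?cardfs1 ?cardfs0.
  rewrite cardfsU; apply: leq_trans (leq_add le1 le).
  by rewrite [X in _ <= X]addnCA leq_add2l leq_subr.
Qed.

(** * Forgetting a label *)

Lemma labelled_forget B u G :
  labelled_by B G -> labelled_by (B `\ u) (forget_label u G).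
Proof.
case=> domB inj; split=> [w|w1 w2 x]; rewrite !fnd_rem1.
  by rewrite in_fsetD1 domB; case: eqP.
by case: eqP => //= _; case: eqP => //= _; apply: inj.
Qed.

Lemma trace_forget u G X : trace (forget_label u G) X = trace G X `\ u.
Proof.
apply/fsetP=> w; rewrite in_fsetD1; apply/traceP/andP => [[x]|[wu /traceP[x wx xX]]].
  by rewrite fnd_rem1; case: eqP => //= _ wx xX; split=> //; apply/traceP; exists x.
by exists x; rewrite // fnd_rem1 wu.
Qed.

(** The graph and its covers are unchanged; deleting [u] from both R and T can only shrink T \ R. *)
Lemma represents_forget u G S : represents G S ->
  represents (forget_label u G)
             (\bigcup_(w <- S) vc_op_hat (ForgetVertex u) w).
Proof.
move=> [[w0 w0S] sound compl].
have inS (w : vc_witness) : w \in S ->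
    (w.1 `\ u, w.2) \in \bigcup_(w <- S) vc_op_hat (ForgetVertex u) w.
  by move=> wS; apply/bigfcupP; exists w; rewrite ?wS ?inE.
split; first by exists (w0.1 `\ u, w0.2); apply: inS.
- move=> w /bigfcupP[w1 /andP[w1S _]]; rewrite inE => /eqP ->.
  have [X cov [cX tX]] := sound _ w1S; exists X => //.
  by rewrite trace_forget tX.
- move=> X /compl[w /inS wS [sub le]]; exists (w.1 `\ u, w.2) => //.
  rewrite trace_forget /=; split; first exact: fsetSD.
  apply: leq_trans le; rewrite leq_add2l; apply: fsubset_leq_card.
  by apply/fsubsetP=> v; rewrite !inE; case: (v == u); case: (v \in w.1).
Qed.

(** * Introducing an edge *)

Lemma labelled_introE B u v G : labelled_by B G -> labelled_by B (add_edge u v G).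
Proof. by []. Qed.

(** The ends of the new edge are the vertices labelled [u] and [v], and its fresh number keeps its
    incidences apart from those of old edges. *)
Lemma vertex_cover_add_edge u v G X :
  vertex_cover (add_edge u v G) X <->
  vertex_cover G X /\ (u \in trace G X) || (v \in trace G X).
Proof.
set e0 := fresh (edges G).
split=> [[XG cov]|[[XG cov] tr]]; split.
- split=> // e eG; have [|x xX] := cov e; first by rewrite in_fset1U eG orbT.
  rewrite in_fsetU => /orP[ex|]; first by exists x.
  rewrite in_fsetM inE /= => /andP[/eqP ee0].
  by rewrite ee0 (negPf (fresh_notin _)) in eG.
- have [|x xX] := cov e0; first by rewrite in_fset1U eqxx.
  rewrite in_fsetU => /orP[/incidence_edge|ex].
    by rewrite (negPf (fresh_notin _)).
  have /orP[/eqP ux|/eqP vx] :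
      ((active G).[? u] == Some x) || ((active G).[? v] == Some x).
    by move: ex; rewrite in_fsetM !inE => /and3P[].
  + by apply/orP; left; apply/traceP; exists x.
  + by apply/orP; right; apply/traceP; exists x.
- by [].
- move=> e; rewrite in_fset1U => /orP[/eqP ->|/cov[x xX ex]].
    by case/orP: tr => /traceP[x ux xX]; exists x => //;
       rewrite in_fsetU in_fsetM !inE /= eqxx ux eqxx (active_vertex ux) ?orbT.
  by exists x => //; rewrite in_fsetU ex.
Qed.

Lemma vertex_cover_add1 (G : lgraph) X u x :
  (active G).[? u] = Some x -> vertex_cover G X -> vertex_cover G (x |` X).
Proof.
move=> ux [XG cov]; split.
  by apply/fsubsetP=> v /fset1UP[->|/(fsubsetP XG)] //; apply: active_vertex ux.
by move=> e /cov[v vX ev]; exists v => //; rewrite in_fset1U vX orbT.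
Qed.

Lemma trace_add1 B (G : lgraph) X u x :
  labelled_by B G -> (active G).[? u] = Some x -> trace G (x |` X) = u |` trace G X.
Proof.
move=> [_ inj] ux; apply/fsetP=> w; rewrite in_fset1U; apply/traceP/idP.
  case=> y wy /fset1UP[yx|yX]; first by rewrite (inj w u x) ?eqxx // -yx.
  by apply/orP; right; apply/traceP; exists y.
case/orP=> [/eqP ->|/traceP[y wy yX]]; first by exists x; rewrite // in_fset1U eqxx.
by exists y; rewrite // in_fset1U yX orbT.
Qed.

(** A witness changes only if R misses both labels. The edge being covered, one of them lies in T;
    moving it from T \ R into R raises s by one and lowers |T \ R| by one, so the bound is kept. *)
Lemma represents_introE B u v G S :
  labelled_by B G -> u \in B -> v \in B -> represents G S ->
  represents (add_edge u v G) (\bigcup_(w <- S) vc_op_hat (IntroEdge u v) w).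
Proof.
move=> labB uB vB [[w0 w0S] sound compl].
have inS w w' : w \in S -> w' \in vc_op_hat (IntroEdge u v) w ->
    w' \in \bigcup_(w <- S) vc_op_hat (IntroEdge u v) w.
  by move=> wS ww'; apply/bigfcupP; exists w; rewrite ?wS.
split.
- have [uv|uv] := boolP ((u \in w0.1) || (v \in w0.1)).
    by exists w0; apply: inS w0S _; rewrite /= uv inE.
  exists (u |` w0.1, w0.2.+1); apply: inS w0S _.
  by rewrite /= (negPf uv) !inE eqxx.
- move=> w /bigfcupP[w1 /andP[w1S _]] /=.
  have [X cov [cX tX]] := sound _ w1S.
  case: ifPn => [uv|uv].
    rewrite inE => /eqP ->; exists X => //.
    by apply/vertex_cover_add_edge; rewrite tX.
  (* The vertex labelled [z] joins the cover; as [z] is outside the trace, the size grows by exactly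
     one. *)
  have ext z : z \in B -> z \notin w1.1 -> (z == u) || (z == v) ->
      exists2 X, vertex_cover (add_edge u v G) X &
        #|` X| = w1.2.+1 /\ trace G X = z |` w1.1.
    move=> zB zw zuv; have [x zx] := labelled_active labB zB.
    exists (x |` X).
      apply/vertex_cover_add_edge; split; first exact: vertex_cover_add1 zx cov.
      rewrite !(trace_add1 _ labB zx) !in_fset1U.
      by case/orP: zuv => /eqP ->; rewrite eqxx ?orbT.
    rewrite (trace_add1 _ labB zx) tX cardfsU1 cX; split=> //.
    suff -> : x \notin X by [].
    apply: contra zw => xX; rewrite -tX; apply/traceP; by exists x.
  case/norP: uv => uw vw.
  by rewrite !inE => /orP[] /eqP ->; apply: ext; rewrite ?eqxx ?orbT.
- move=> X /vertex_cover_add_edge[/compl[w wS [sub le]] tr].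
  have trE : trace (add_edge u v G) X = trace G X by [].
  rewrite trE.
  have [uv|uv] := boolP ((u \in w.1) || (v \in w.1)).
    by exists w => //; apply: inS wS _; rewrite /= uv inE.
  have ext z : z \in trace G X -> z \notin w.1 -> (z == u) || (z == v) ->
      exists2 w', w' \in \bigcup_(w <- S) vc_op_hat (IntroEdge u v) w &
        w'.1 `<=` trace G X /\ w'.2 + #|` trace G X `\` w'.1| <= #|` X|.
    move=> zX zw zuv; exists (z |` w.1, w.2.+1) => /=.
      apply: inS wS _; rewrite /= (negPf uv) !inE.
      by case/orP: zuv => /eqP ->; rewrite eqxx ?orbT.
    split; first by rewrite fsubUset fsub1set zX.
    apply: leq_trans le; rewrite (cardfsD1 z (trace G X `\` w.1)).
    have -> : trace G X `\` (z |` w.1) = trace G X `\` w.1 `\ z.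
      by apply/fsetP=> y; rewrite !in_fsetD in_fset1U in_fset1 negb_or andbA.
    by rewrite in_fsetD zw zX addnS.
  case/norP: (uv) => uw vw.
  by case/orP: tr => zX; apply: ext zX _ _; rewrite ?eqxx ?orbT.
Qed.

(** * Gluing two graphs with the same label set *)

Section Glue.

Variables (B : {fset nat}) (G1 G2 : lgraph).
Hypotheses (lab1 : labelled_by B G1) (lab2 : labelled_by B G2).

Let g := glue_vertex G1 G2.

(** Both graphs have the label set [B], so a vertex with any label in [G2] is shared; only
    unlabelled vertices get shifted copies. *)
Variant glue_vertex_spec y : nat -> Prop :=
| GlueShared u x of (active G1).[? u] = Some x & (active G2).[? u] = Some y :
    glue_vertex_spec y x
| GlueFresh of (forall u, (active G2).[? u] <> Some y) :
    glue_vertex_spec y (fresh (vertices G1) + y).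

Lemma glue_vertexP y : glue_vertex_spec y (g y).
Proof.
rewrite /g /glue_vertex; case: pickP => [x /hasP[u _ /andP[/eqP ux /eqP uy]]|no].
  exact: GlueShared ux uy.
apply: GlueFresh => u uy.
have uB : u \in B by rewrite lab2.1 uy.
have [x ux] := labelled_active lab1 uB.
have /negP[] := no [` active_vertex ux]; apply/hasP; exists u => /=.
  by case: fndP ux.
by rewrite ux uy !eqxx.
Qed.

Lemma glue_vertex_active u x y :
  (active G1).[? u] = Some x -> (active G2).[? u] = Some y -> g y = x.
Proof.
move=> ux uy; case: glue_vertexP => [w z wz wy|/(_ u)//].
by rewrite (lab2.2 _ _ _ wy uy) ux in wz; case: wz.
Qed.

Lemma glue_vertex_shared y : g y \in vertices G1 ->
  exists2 u, (active G1).[? u] = Some (g y) & (active G2).[? u] = Some y.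
Proof.
by case: glue_vertexP => [u x ux uy|_]; [exists u|rewrite (negPf (fresh_addn_notin _ _))].
Qed.

(** Shared vertices with one image have the same label, hence are equal; shifted copies avoid [G1]
    and differ among themselves. *)
Lemma glue_vertex_inj : injective g.
Proof.
move=> y y'; case: (glue_vertexP y) => [u x ux uy|_];
  case: (glue_vertexP y') => [u' x' ux' uy'|_].
- by move=> xx'; move: uy; rewrite -xx' in ux'; rewrite (lab1.2 _ _ _ ux ux') uy' => -[].
- move=> xE; have := active_vertex ux.
  by rewrite xE (negPf (fresh_addn_notin _ _)).
- move=> xE; have := active_vertex ux'.
  by rewrite -xE (negPf (fresh_addn_notin _ _)).
- exact: addnI.
Qed.

(** [active G1] takes precedence in the concatenation, and the other map has the same domain [B]. *)
Lemma glue_activeE u : (active (glue G1 G2)).[? u] = (active G1).[? u].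
Proof.
rewrite (_ : active (glue G1 G2) = glue_active G1 G2) // fnd_cat; case: ifP => // u1.
have none1 : (active G1).[? u] = None by rewrite not_fnd ?u1.
have : ~~ isSome (active G2).[? u] by rewrite -lab2.1 lab1.1 none1.
by case: fndP => // u2 _; rewrite none1 not_fnd.
Qed.

Lemma labelled_glue : labelled_by B (glue G1 G2).
Proof.
by split=> [u|u w x]; rewrite !glue_activeE; [exact: lab1.1|exact: lab1.2].
Qed.

Let union (X1 X2 : {fset nat}) := X1 `|` [fset g y | y in X2].

(** An image under [g] that carries a label is a shared vertex, so its preimage carries the same
    label in [G2]. *)
Lemma trace_glue X1 X2 : X2 `<=` vertices G2 ->
  trace (glue G1 G2) (union X1 X2) = trace G1 X1 `|` trace G2 X2.
Proof.
move=> X2G; apply/fsetP=> u; rewrite in_fsetU; apply/traceP/orP.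
  case=> x; rewrite glue_activeE => ux /fsetUP[xX|/imfsetP[y /= yX xE]].
    by left; apply/traceP; exists x.
  rewrite xE in ux; right; apply/traceP; exists y => //.
  have [w wx wy] := glue_vertex_shared (active_vertex ux).
  by rewrite (lab1.2 _ _ _ ux wx).
case=> /traceP[x ux xX].
  by exists x; rewrite ?glue_activeE // in_fsetU xX.
have [|z uz] := @labelled_active _ _ u lab1; first by rewrite lab2.1 ux.
exists z; rewrite ?glue_activeE // in_fsetU -(glue_vertex_active uz ux).
by rewrite in_imfset ?orbT.
Qed.

(** Inclusion-exclusion: [X1] and the image of [X2] overlap in one vertex per common label of the
    traces. This explains the term subtracted in [vc_join_hat]. *)
Lemma card_glue X1 X2 : X1 `<=` vertices G1 ->
  #|` union X1 X2| + #|` trace G1 X1 `&` trace G2 X2| = #|` X1| + #|` X2|.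
Proof.
move=> X1G.
have -> : #|` X2| = #|` [fset g y | y in X2]|.
  by rewrite card_imfset //; exact: glue_vertex_inj.
rewrite -[RHS]cardfsUI; congr (_ + _).
pose h u := odflt 0 (active G1).[? u].
have -> : X1 `&` [fset g y | y in X2] =
    [fset h u | u in trace G1 X1 `&` trace G2 X2].
  apply/fsetP=> x; rewrite in_fsetI.
  apply/andP/imfsetP => [|[u /= /fsetIP[/traceP[y uy yX] /traceP[z uz zX]] ->]].
    case=> xX /imfsetP[y /= yX xE].
    have [|u ux uy] := @glue_vertex_shared y; first by rewrite -xE (fsubsetP X1G).
    exists u; last by rewrite /h ux.
    by apply/fsetIP; split; apply/traceP; [exists x; rewrite // xE|exists y].
  rewrite /h uy; split=> //=.
  by rewrite -(glue_vertex_active uy uz) in_imfset.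
rewrite [RHS]card_in_imfset // => u w.
move=> /fsetIP[/traceP[x ux _] _] /fsetIP[/traceP[y wy _] _].
rewrite /h ux wy /= => xy; rewrite -xy in wy; exact: lab1.2 ux wy.
Qed.

Lemma vertex_cover_union X1 X2 :
  vertex_cover G1 X1 -> vertex_cover G2 X2 -> vertex_cover (glue G1 G2) (union X1 X2).
Proof.
move=> [X1G cov1] [X2G cov2]; split.
  apply: fsetUSS => //; apply/fsubsetP => x /imfsetP[y /= yX ->].
  by rewrite in_imfset //; apply: (fsubsetP X2G).
move=> e; rewrite in_fsetU => /orP[/cov1[x xX ex]|/imfsetP[e' /= /cov2[y yX ey] ->]].
  by exists x; rewrite in_fsetU ?xX ?ex.
exists (g y); first by rewrite in_fsetU in_imfset ?orbT.
rewrite in_fsetU; apply/orP; right; apply/imfsetP; by exists (e', y).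
Qed.

(** A label names the same glued vertex from both sides, so the restrictions of [X] to the two sides
    have a common trace; completeness at joins rests on this. *)
Lemma vertex_cover_glue X : vertex_cover (glue G1 G2) X ->
  exists X1 X2, [/\ vertex_cover G1 X1, vertex_cover G2 X2, X = union X1 X2 &
    trace G1 X1 = trace G2 X2].
Proof.
move=> [XG cov].
exists (X `&` vertices G1), [fset y in vertices G2 | g y \in X].
have glueP e v : (e, v) \in glue_incidence G1 G2 ->
    (e, v) \in incidence G1 \/
    exists e' v', [/\ (e', v') \in incidence G2, e = glue_edge G1 e' & v = g v'].
  rewrite in_fsetU => /orP[|/imfsetP[[e' v'] /= ev [-> ->]]]; [by left|right].
  by exists e', v'.
split.
- split=> [|e eG]; first exact: fsubsetIr.
  have [|v vX /glueP[ev|[e' [_ [_ eE _]]]]] := cov e; first by rewrite in_fsetU eG.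
    by exists v; rewrite // in_fsetI vX (incidence_vertex ev).
  by rewrite eE (negPf (fresh_addn_notin _ _)) in eG.
- split=> [|e eG]; first by apply/fsubsetP=> y; rewrite !inE => /andP[].
  have [|v vX /glueP[/incidence_edge|[e' [v' [ev /addnI -> vE]]]]] :=
    cov (glue_edge G1 e).
  + by rewrite in_fsetU in_imfset ?orbT.
  + by rewrite (negPf (fresh_addn_notin _ _)).
  + by exists v'; rewrite // !inE (incidence_vertex ev) /= -vE.
- apply/fsetP=> x; rewrite in_fsetU in_fsetI; apply/idP/orP.
    move=> xX; have := fsubsetP XG _ xX; rewrite in_fsetU => /orP[xG|].
      by left; rewrite xX.
    case/imfsetP=> y /= yG xE; right; rewrite xE in_imfset //= !inE yG /=.
    by rewrite -/g in xE; rewrite -xE.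
  by case=> [/andP[]//|/imfsetP[y /=]]; rewrite !inE => /andP[_ gX] ->.
- apply/fsetP=> u; apply/traceP/traceP => -[x ux].
    rewrite in_fsetI => /andP[xX _].
    have [|y uy] := @labelled_active _ _ u lab2; first by rewrite lab1.1 ux.
    by exists y; rewrite // !inE (active_vertex uy) (glue_vertex_active ux uy).
  rewrite !inE => /andP[_ gX].
  have [|y uy] := @labelled_active _ _ u lab1; first by rewrite lab2.1 ux.
  exists y; rewrite // in_fsetI (active_vertex uy) andbT.
  by rewrite -(glue_vertex_active uy ux).
Qed.

(** Soundness unites two covers. For completeness, with T the common trace, the bounds s_i + |T \
    R_i| <= |X_i| are added; |X| = |X1| + |X2| - |T| and inclusion-exclusion for R1, R2 turn the sum
    into the required bound. *)
Lemma represents_join S1 S2 : represents G1 S1 -> represents G2 S2 ->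
  represents (glue G1 G2)
    (\bigcup_(w1 <- S1) \bigcup_(w2 <- S2) vc_join_hat w1 w2).
Proof.
move=> [[w1 w1S] sound1 compl1] [[w2 w2S] sound2 compl2].
pose jn (w w' : vc_witness) : vc_witness :=
  (w.1 `|` w'.1, w.2 + w'.2 - #|` w.1 `&` w'.1|).
have inS w w' : w \in S1 -> w' \in S2 ->
    jn w w' \in \bigcup_(w1 <- S1) \bigcup_(w2 <- S2) vc_join_hat w1 w2.
  move=> wS w'S; apply/bigfcupP; exists w; first by rewrite wS.
  by apply/bigfcupP; exists w'; rewrite ?w'S // inE.
split; first by exists (jn w1 w2); apply: inS.
- move=> w /bigfcupP[v1 /andP[v1S _]] /bigfcupP[v2 /andP[v2S _]].
  rewrite inE => /eqP ->.
  have [X1 cov1 [c1 t1]] := sound1 _ v1S.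
  have [X2 cov2 [c2 t2]] := sound2 _ v2S.
  exists (union X1 X2); first exact: vertex_cover_union.
  rewrite trace_glue ?t1 ?t2; last exact: cov2.1.
  by split=> //=; rewrite -c1 -c2 -card_glue ?t1 ?t2 ?addnK //; exact: cov1.1.
- move=> X /vertex_cover_glue[X1 [X2 [cov1 cov2 -> tE]]].
  have [v1 v1S [sub1 le1]] := compl1 _ cov1.
  have [v2 v2S [sub2 le2]] := compl2 _ cov2.
  exists (jn v1 v2); first exact: inS.
  have cardU := card_glue X2 cov1.1.
  rewrite trace_glue; last exact: cov2.1.
  rewrite -tE fsetIid in sub2 le2 cardU *; rewrite fsetUid /=.
  set T := trace G1 X1 in sub1 sub2 le1 le2 cardU *.
  split; first by rewrite fsubUset sub1.
  have cD R : R `<=` T -> #|` T `\` R| + #|` R| = #|` T|.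
    by move=> RT; rewrite -(cardfsID R T) (fsetIidPr RT) addnC.
  (* The bounds |T| <= |X_i| settle the case where the subtraction in the joined cost is truncated
     at 0. *)
  have := leq_card_trace X1 lab1; have := leq_card_trace X2 lab2; rewrite -tE -/T.
  have := cD _ sub1; have := cD _ sub2.
  have := cD (v1.1 `|` v2.1); rewrite fsubUset sub1 sub2 => /(_ isT).
  have := cardfsUI v1.1 v2.1.
  move: (v1.2) (v2.2) le1 le2 cardU => s1 s2.
  move: (#|` T|) (#|` X1|) (#|` X2|) (#|` union X1 X2|) => nT n1 n2 n.
  move: (#|` v1.1|) (#|` v2.1|) (#|` v1.1 `|` v2.1|) (#|` v1.1 `&` v2.1|).
  move: (#|` T `\` v1.1|) (#|` T `\` v2.1|) (#|` T `\` (v1.1 `|` v2.1)|).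
  lia.
Qed.

End Glue.

(** * Induction along runs of the automaton *)

(** The states of the run supply the side conditions: [u \notin B] for a new vertex, active ends for
    a new edge, equal label sets at a join. *)
Lemma reaches_represents k t B : reaches k t B ->
  labelled_by B (lgraph_of t) /\ represents (lgraph_of t) (Dyn (VC k) t).
Proof.
elim=> {t B} [|a t B B' _ _ [lab rep] aBB'|t1 t2 B _ [lab1 rep1] _ [lab2 rep2]].
- split; last exact: represents_leaf.
  by split=> [u|u w x]; rewrite !fnd_fmap0 ?inE.
- case: aBB' lab rep => [u {}B uB|u {}B uB|u v {}B uB vB] lab rep; split.
  + exact: labelled_introV.
  + exact/represents_clean/(represents_introV lab).
  + exact: labelled_forget.
  + exact/represents_clean/represents_forget.
  + exact: labelled_introE.
  + exact/represents_clean/(represents_introE lab).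
- split; first exact: labelled_glue.
  exact/represents_clean/(represents_join lab1 lab2).
Qed.

(** * Reading off the minimum *)

Lemma bigminn_le (T : eqType) (s : seq T) (F : T -> nat) d x :
  x \in s -> \big[minn/d]_(y <- s) F y <= F x.
Proof.
elim: s => // y s IHs; rewrite inE big_cons => /orP[/eqP <-|/IHs le].
  exact: geq_minl.
exact: leq_trans (geq_minr _ _) le.
Qed.

(** [minn] has no neutral element on [nat], so the default can survive as the value even for
    nonempty [s]. *)
Lemma bigminn_attained (T : eqType) (s : seq T) (F : T -> nat) d :
  \big[minn/d]_(y <- s) F y = d \/
  exists2 x, x \in s & F x = \big[minn/d]_(y <- s) F y.
Proof.
elim: s => [|y s IHs]; first by rewrite big_nil; left.
rewrite big_cons; case: (leqP (F y) (\big[minn/d]_(z <- s) F z)) => _.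
  by right; exists y; rewrite ?mem_head.
by case: IHs => [->|[x xs xE]]; [left|right; exists x; rewrite // inE xs orbT].
Qed.

Lemma vc_min_attained (S : {fset vc_witness}) w0 :
  w0 \in S -> exists2 w, w \in S & w.2 = vc_min S.
Proof.
move=> w0S; rewrite /vc_min.
have [mE|//] := @bigminn_attained _ (enum_fset S) (fun w : vc_witness => w.2)
  (\max_(w <- S) w.2).
(* Here the minimum equals its default, the maximum of the costs, so the cost of [w0] is squeezed
   between them. *)
exists w0 => //; apply/eqP; rewrite eqn_leq.
rewrite [X in _ && X]bigminn_le // andbT mE.
exact: (@leq_bigmax_seq _ (enum_fset S) xpredT (fun w : vc_witness => w.2)).
Qed.

(** Soundness turns a cheapest witness into a cover; completeness gives the lower bound once |T \ R|
    is dropped. *)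
Lemma represents_min G S : represents G S -> min_vertex_cover_size G (vc_min S).
Proof.
case=> -[w0 /vc_min_attained[w wS wE]] sound compl; split.
  rewrite -wE; by have [X cov [cX _]] := sound _ wS; exists X.
move=> X /compl[w' w'S [_ le]].
apply: leq_trans (leq_trans (leq_addr _ _) le).
exact: (@bigminn_le _ (enum_fset S) (fun w : vc_witness => w.2)).
Qed.

Lemma L_min_vertex_cover k t :
  L k t -> min_vertex_cover_size (graph_of t) (vc_min (Dyn (VC k) t)).
Proof. by case=> B /reaches_represents[_ /represents_min]. Qed.

(** * Invariance under isomorphism *)

Lemma graph_iso_refl G : graph_iso G G.
Proof. by exists id, id; split=> //; exists id. Qed.

Lemma graph_iso_sym G H : graph_iso G H -> graph_iso H G.
Proof.
case=> f [h [[f' fK f'K] [h' hK h'K] fhE]]; exists f', h'.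
by split=> [||e v]; [exists f|exists h|rewrite fhE h'K f'K].
Qed.

Lemma graph_iso_cover G H X : graph_iso G H -> vertex_cover G X ->
  exists2 Y, vertex_cover H Y & #|` Y| = #|` X|.
Proof.
case=> f [h [bijf [h' hK h'K] fhE]] [XG cov].
(* [F] extends [f] to all numbers; the default 0 is never met because [X] lies in the vertices of
   [G]. *)
pose F x := if insub x is Some x' then val (f x') else 0.
have FE x (xG : x \in vertices G) : F x = val (f [` xG]).
  by rewrite /F insubT.
exists [fset F x | x in X].
  split.
    by apply/fsubsetP=> y /imfsetP[x /= /(fsubsetP XG) xG ->]; rewrite FE fsvalP.
  move=> e eH; have [x xX ex] := cov _ (fsvalP (h' [` eH])).
  have xG := fsubsetP XG _ xX; exists (F x); first by rewrite in_imfset.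
  by have := fhE (h' [` eH]) [` xG]; rewrite ex h'K FE.
rewrite card_in_imfset // => x y /(fsubsetP XG) xG /(fsubsetP XG) yG.
by rewrite !FE => /val_inj /(bij_inj bijf) [].
Qed.

Lemma graph_iso_min G H n :
  graph_iso G H -> min_vertex_cover_size G n -> min_vertex_cover_size H n.
Proof.
move=> GH [[X covX cX] min]; split.
  by have [Y covY cY] := graph_iso_cover GH covX; exists Y; rewrite // cY.
move=> Y /(graph_iso_cover (graph_iso_sym GH))[Z covZ <-]; exact: min.
Qed.

Lemma min_vertex_cover_size_inj G m n :
  min_vertex_cover_size G m -> min_vertex_cover_size G n -> m = n.
Proof.
move=> [[X covX <-] minX] [[Y covY <-] minY].
by apply/eqP; rewrite eqn_leq minX // minY.
Qed.

(** * Least index and independence of the decomposition *)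

(** [P] is an arbitrary proposition, so excluded middle decides whether a smaller element exists. *)
Lemma ex_least (P : nat -> Prop) n :
  P n -> exists2 m, P m & forall j, P j -> m <= j.
Proof.
elim/ltn_ind: n => n IHn Pn.
have [[j ltjn Pj]|no] := classic (exists2 j, j < n & P j); first exact: IHn Pj.
by exists n => // j Pj; rewrite leqNgt; apply/negP=> ltjn; apply: no; exists j.
Qed.

Theorem theorem3 (k : nat) (t : term) (ht : L k t) :
  exists n : nat,
    min_vertex_cover_size (graph_of t) n /\
    core_inv VC (graph_of t) (binary n).
Proof.
have min_t := L_min_vertex_cover ht.
exists (vc_min (Dyn (VC k) t)); split=> //; split.
  (* The given [k] need not be least for [t], whereas [decomposes] asks for the least index. *)
  have [m mL le] := @ex_least (L^~ t) k ht.
  by exists m, t; split=> //; exact: graph_iso_refl.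
(* The program on [t'] yields the minimum cover size of its own graph; the isomorphism transfers it
   to the graph of [t], where this minimum is unique. *)
move=> k' t' [/L_min_vertex_cover min_t' _ iso] /=; congr binary.
exact: min_vertex_cover_size_inj (graph_iso_min iso min_t') min_t.
Qed.
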